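(* Let $G$ be a connected cograph with at least two vertices. Let $k$ be the number of nontrivial connected components of $\overline{G}$ and $t$ the number of trivial connected components of $\overline{G}$. Then: (i) if $k = 0$, then $h(G\overline{G}) = t$; (ii) if $k = 1$, letting $\overline{G}_1$ be the nontrivial component of $\overline{G}$ and $G_1$ the subgraph of $G$ induced by the vertices corresponding to $V(\overline{G}_1)$, we have $t+2 \leq h(G\overline{G}) \leq \min\{h(G_1), h(\overline{G}_1)\} + t$; (iii) if $k \geq 2$, then $h(G\overline{G}) = k + t + 1$.
   Context: All graphs are finite, simple and undirected. A cograph is a graph with no induced path on four vertices. For a graph $H$ and $x,y \in V(H)$, the closed interval $I[x,y]$ consists of $x$, $y$ and all vertices lying on some shortest path between $x$ and $y$ in $H$; for $S \subseteq V(H)$, $I[S] = \bigcup_{x,y\in S} I[x,y]$. A set $S$ is (geodetically) convex if $I[S]=S$; the convex hull $H(S)$ is the smallest convex set containing $S$; $S$ is a hull set if $H(S)=V(H)$; the (geodetic) hull number $h(H)$ is the minimum cardinality of a hull set of $H$ (hull numbers of $G_1$, $\overline{G}_1$ are taken in those graphs on their own). For a graph $G$ with vertex set $\{v_1,\dots,v_n\}$, the complementary prism $G\overline{G}$ has vertex set $\{v_1,\dots,v_n\}\cup\{\overline{v}_1,\dots,\overline{v}_n\}$ and edge set $E(G) \cup \{\overline{v}_i\overline{v}_j : i<j,\ v_iv_j\notin E(G)\} \cup \{v_i\overline{v}_i : 1\le i\le n\}$; $v_i$ and $\overline{v}_i$ are corresponding vertices. A component is trivial if it has exactly one vertex, nontrivial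 otherwise. *)

(* Defs.v *)
From HB Require Import structures.
From mathcomp Require Import all_boot.

Set Implicit Arguments.
Unset Strict Implicit.
Unset Printing Implicit Defensive.

Record sgraph := SGraph {
  vertex :> finType;
  adj : rel vertex;
  adj_sym : symmetric adj;
  adj_irr : irreflexive adj }.

Section Constructions.
Variable G : sgraph.

Definition compl_adj : rel G := fun x y => (x != y) && ~~ adj x y.

Lemma compl_adj_sym : symmetric compl_adj.
Proof. by move=> x y; rewrite /compl_adj eq_sym (adj_sym x y). Qed.

Lemma compl_adj_irr : irreflexive compl_adj.
Proof. by move=> x; rewrite /compl_adj eqxx. Qed.

Definition compl : sgraph := SGraph compl_adj_sym compl_adj_irr.

Definition induced_adj (C : {set G}) : rel {x : G | x \in C} :=
  fun x y => adj (val x) (val y).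

Lemma induced_adj_sym C : symmetric (@induced_adj C).
Proof. by move=> x y; apply: adj_sym. Qed.

Lemma induced_adj_irr C : irreflexive (@induced_adj C).
Proof. by move=> x; apply: adj_irr. Qed.

Definition induced (C : {set G}) : sgraph :=
  SGraph (@induced_adj_sym C) (@induced_adj_irr C).

(* [inl v] is the vertex v of G, [inr v] is the corresponding vertex of the
   complement. *)
Definition cprism_adj : rel (G + G)%type := fun u v =>
  match u, v with
  | inl x, inl y => adj x y
  | inr x, inr y => compl_adj x y
  | inl x, inr y | inr x, inl y => x == y
  end.

Lemma cprism_adj_sym : symmetric cprism_adj.
Proof.
move=> [x|x] [y|y] /=; [exact: adj_sym | exact: eq_sym | exact: eq_sym |].
exact: compl_adj_sym.
Qed.

Lemma cprism_adj_irr : irreflexive cprism_adj.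
Proof. by case=> x; [apply: adj_irr | apply: compl_adj_irr]. Qed.

Definition cprism : sgraph := SGraph cprism_adj_sym cprism_adj_irr.

End Constructions.

Arguments induced G C : clear implicits.

Section Connectivity.
Variable G : sgraph.

Definition connected : Prop := forall x y : G, connect (@adj G) x y.

Definition components : {set {set G}} :=
  [set [set y | connect (@adj G) x y] | x : G].

Definition nontrivial_components : {set {set G}} :=
  [set C in components | 1 < #|C|].

Definition trivial_components : {set {set G}} :=
  [set C in components | #|C| == 1].

Definition cograph : Prop :=
  ~ exists2 f : 'I_4 -> G, injective f &
      forall i j : 'I_4, adj (f i) (f j) = (i.+1 == j) || (j.+1 == i).

End Connectivity.

Section Geodetic.
Variable G : sgraph.

(* [x :: p] is the vertex sequence of a path from x to y; its length is
   [size p]. *)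
Definition gpath (x y : G) (p : seq G) : bool :=
  [&& path (@adj G) x p, last x p == y & uniq (x :: p)].

Definition shortest_gpath (x y : G) (p : seq G) : bool :=
  gpath x y p &&
  [forall n : 'I_(size p), forall q : n.-tuple G, ~~ gpath x y q].

(* As the vertices of a path are distinct, its length is less than #|G|. *)
Definition interval (x y : G) : {set G} :=
  [set x; y] :|:
  [set z | [exists n : 'I_#|G|, exists p : n.-tuple G,
              shortest_gpath x y p && (z \in x :: p)]].

Definition interval_set (S : {set G}) : {set G} :=
  \bigcup_(x in S) \bigcup_(y in S) interval x y.

Definition convex (S : {set G}) : bool := interval_set S == S.

Definition hull (S : {set G}) : {set G} :=
  \bigcap_(C : {set G} | convex C && (S \subset C)) C.

Definition hull_set (S : {set G}) : bool := hull S == [set: G].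

(* [set: G] is always a hull set, so the minimum is over a nonempty family. *)
Definition hull_number : nat :=
  #|[arg min_(S < [set: G] | hull_set S) #|S|]|.

End Geodetic.

(* Main.v *)
Require Import Defs.
From mathcomp Require Import all_boot.

Set Implicit Arguments.
Unset Strict Implicit.
Unset Printing Implicit Defensive.

(* In the prism, two vertices of G, or a vertex of G and a vertex of the
   complement, are at distance at most 2, and so are two vertices of the complement
   lying in one co-component (a component of the complement of G).  If x and y lie
   in different co-components, the only geodesic between their copies in the
   complement runs through x and y.  Hence convexity in the prism reduces to
   convexity of the traces on G and on its complement together with three closure
   rules (cprism_convexP).

   Lower bounds: deleting the complement copy of one co-component leaves a convex
   set, so a hull set meets each of these copies, and when some co-component is
   nontrivial one vertex per copy is not enough.  Upper bounds: by Seinsche's theorem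
   there are at least two co-components, so G lies in the hull as soon as its
   complement does; and once all of G is in the hull, each co-component fills up
   from any one of its vertices. *)

Section Components.
Variable H : sgraph.
Implicit Types (x y : H) (S C : {set H}).

Definition component x : {set H} := [set y | connect (@adj H) x y].

Definition isolated : {set H} := [set x : H | [forall y, ~~ adj x y]].

Lemma adj_neq x y : adj x y -> x != y.
Proof. by apply: contraTneq => ->; rewrite adj_irr. Qed.

Lemma adj_connect_sym : connect_sym (@adj H).
Proof. exact: sym_connect_sym (@adj_sym H). Qed.

Lemma mem_component x : x \in component x.
Proof. by rewrite inE connect0. Qed.

Lemma card_component_gt0 x : 0 < #|component x|.
Proof. by apply/card_gt0P; exists x; apply: mem_component. Qed.

Lemma eq_component x y : (component x == component y) = connect (@adj H) x y.
Proof.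
apply/eqP/idP=> [exy | xy]; first by have := mem_component y; rewrite -exy inE.
by apply/setP=> z; rewrite !inE (same_connect adj_connect_sym xy).
Qed.

Lemma component_in_components x : component x \in components H.
Proof. exact: imset_f. Qed.

Lemma isolatedPn x : reflect (exists y, adj x y) (x \notin isolated).
Proof.
rewrite inE negb_forall.
by apply: (iffP existsP) => -[y xy]; exists y; rewrite negbK in xy *.
Qed.

Lemma isolated_connect_eq x y : x \in isolated -> connect (@adj H) x y -> x = y.
Proof.
rewrite inE => /forallP isox /connectP[[|z p] /=]; first by move=> _ ->.
by case/andP=> xz; have := isox z; rewrite xz.
Qed.

Lemma card_component_gt1 x : (1 < #|component x|) = (x \notin isolated).
Proof.
apply/idP/isolatedPn => [|[y xy]].
  rewrite (cardsD1 x) mem_component ltnS card_gt0 => /set0Pn[y /setD1P[yx xy]].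
  apply/isolatedPn; apply: contra yx => isox; rewrite inE in xy.
  by rewrite (isolated_connect_eq isox xy).
by apply/card_gt1P; exists x, y; rewrite !inE connect0 connect1 ?adj_neq.
Qed.

Lemma connect_isolated x y :
  connect (@adj H) x y -> (x \in isolated) = (y \in isolated).
Proof.
by rewrite -eq_component => /eqP exy; apply/negb_inj; rewrite -!card_component_gt1 exy.
Qed.

Lemma component_nontrivial x :
  (component x \in nontrivial_components H) = (x \notin isolated).
Proof. by rewrite inE component_in_components card_component_gt1. Qed.

Lemma nontrivial_componentsE :
  nontrivial_components H = component @: ~: isolated.
Proof.
apply/setP=> C; apply/idP/imsetP=> [CN | [x xN ->]]; last first.
  by rewrite component_nontrivial -in_setC.
have /imsetP[x _ CE] : C \in components H by case/setIdP: CN.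
by exists x; rewrite // in_setC -component_nontrivial /component -CE.
Qed.

Lemma nontrivial_components_gt0P :
  reflect (exists x y, adj x y) (0 < #|nontrivial_components H|).
Proof.
rewrite nontrivial_componentsE card_gt0 imset_eq0.
apply: (iffP (set0Pn _)) => -[x xN]; exists x; last by rewrite in_setC; apply/isolatedPn.
by apply/isolatedPn; rewrite -in_setC.
Qed.

Lemma isolatedT : #|nontrivial_components H| = 0 -> isolated = [set: H].
Proof.
rewrite nontrivial_componentsE => /eqP; rewrite cards_eq0 imset_eq0 => /eqP isoC.
by rewrite -[LHS]setCK isoC setC0.
Qed.

Lemma isolated_setC C : #|nontrivial_components H| = 1 ->
  C \in nontrivial_components H -> isolated = ~: C.
Proof.
move=> /eqP/cards1P[D ND] CN; have {D} ND : nontrivial_components H = [set C].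
  by move: CN; rewrite ND inE => /eqP->.
apply/setP=> x; apply/negb_inj; rewrite -component_nontrivial ND !inE negbK.
move: CN; rewrite nontrivial_componentsE => /imsetP[a _ ->].
by rewrite eq_component adj_connect_sym inE.
Qed.

Lemma card_trivial_components : #|trivial_components H| = #|isolated|.
Proof.
have -> : trivial_components H = set1 @: isolated; last exact: card_imset set1_inj.
apply/setP=> C; rewrite inE.
apply/andP/imsetP=> [[/imsetP[x _ ->]] | [x isox ->]].
  rewrite -/(component x) => /cards1P[y xE]; exists x; last first.
    by move: (mem_component x); rewrite xE inE => /eqP->.
  by apply/negPn; rewrite -card_component_gt1 xE cards1.
have -> : [set x] = component x.
  by apply/setP=> y; rewrite !inE; apply/eqP/idP=> [-> // | /(isolated_connect_eq isox)].
split; first exact: component_in_components.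
by rewrite eqn_leq leqNgt card_component_gt1 isox card_component_gt0.
Qed.

Lemma card_components :
  #|components H| = #|nontrivial_components H| + #|trivial_components H|.
Proof.
rewrite -(cardsID (nontrivial_components H)); congr (_ + _); apply: eq_card => C.
  by rewrite !inE andbA andbb.
rewrite !inE andbC; case: (boolP (C \in _)) => //= /imsetP[x _ ->].
by rewrite -leqNgt eqn_leq card_component_gt0 andbT.
Qed.

Lemma card_roots : #|roots (@adj H)| = #|components H|.
Proof.
rewrite -(card_in_imset (f := component) (D := roots (@adj H))) => [|x y]; last first.
  move=> /eqP xr /eqP yr /eqP; rewrite eq_component => /(rootP adj_connect_sym).
  by rewrite xr yr.
apply: eq_card => C; apply/imsetP/imsetP => -[x _ ->]; first by exists x.
exists (root (@adj H) x); first exact: roots_root adj_connect_sym x.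
by apply/eqP; rewrite eq_component connect_root.
Qed.

End Components.

Arguments isolated : clear implicits.

Lemma compl_adjK (H : sgraph) (x y : H) : @adj (compl (compl H)) x y = adj x y.
Proof.
rewrite /= /compl_adj negb_and !negbK andb_orr andNb /=.
by case: (boolP (adj x y)) => [/adj_neq->|]; rewrite ?andbF.
Qed.

Section Embeddings.
Variables H K : sgraph.

Definition embedding (f : H -> K) : Prop :=
  injective f /\ {mono f : x y / adj x y}.

Lemma cograph_embedding (f : H -> K) : embedding f -> cograph K -> cograph H.
Proof.
move=> [injf monof] cK [g injg adjg]; apply: cK; exists (f \o g); first exact: inj_comp.
by move=> i j; rewrite /= monof.
Qed.

End Embeddings.

Lemma embedding_val (H : sgraph) (C : {set H}) : embedding (val : induced H C -> H).
Proof. by split; first exact: val_inj. Qed.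

Lemma embedding_inl (H : sgraph) : embedding (inl : H -> cprism H).
Proof. by split; first exact: inl_inj. Qed.

Lemma embedding_inr (H : sgraph) : embedding (inr : compl H -> cprism H).
Proof. by split; first exact: inr_inj. Qed.

Lemma cograph_P4_free (H : sgraph) (a b c d : H) : cograph H ->
  adj a b -> adj b c -> adj c d -> ~~ adj a c -> ~~ adj b d -> adj a d.
Proof.
move=> cH ab bc cd /negbTE nac /negbTE nbd; apply: contraT => /negbTE nad.
case: cH; pose s := [:: a; b; c; d].
have us : uniq s.
  have ac : a != c by apply: contraTneq cd => <-; rewrite nad.
  have bd : b != d by apply: contraTneq ab => ->; rewrite nad.
  have ad : a != d by apply: contraTneq ab => ->; rewrite adj_sym nbd.
  by rewrite /= !inE !negb_or ac bd ad (adj_neq ab) (adj_neq bc) (adj_neq cd).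
exists (fun i : 'I_4 => nth a s i).
  by move=> i j /eqP; rewrite nth_uniq // => /eqP/val_inj.
case=> [[|[|[|[|i]]]] // ?] [[|[|[|[|j]]]] // ?] /=;
  by rewrite ?adj_irr ?(ab, bc, cd, nac, nbd, nad) // adj_sym ?(ab, bc, cd, nac, nbd, nad).
Qed.

(* The complement of the path 0-1-2-3 is the path 1-3-0-2. *)
Lemma cograph_compl (H : sgraph) : cograph H -> cograph (compl H).
Proof.
move=> cH [f injf adjf].
have adjfN i j : i != j -> @adj H (f i) (f j) = ~~ ((i.+1 == j) || (j.+1 == i)).
  by move=> ij; rewrite -adjf /= /compl_adj (inj_eq injf) ij negbK.
pose o i (lti4 : i < 4) : 'I_4 := Ordinal lti4.
have : @adj H (f (@o 1 isT)) (f (@o 2 isT)).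
  by apply: (@cograph_P4_free H _ (f (@o 3 isT)) (f (@o 0 isT))); rewrite // adjfN.
by rewrite adjfN.
Qed.

Section Splitting.
Variable H : sgraph.
Implicit Types (x y v : H) (A B : {set H}).

Definition splits A B : bool :=
  [&& B \proper A, B != set0 & [forall x in B, forall y in A :\: B, ~~ adj x y]].

Definition splittable A : bool := [exists B, splits A B].

Lemma splitsP A B : reflect
  [/\ B \proper A, B != set0 & {in B & A :\: B, forall x y, ~~ adj x y}] (splits A B).
Proof.
apply: (iffP and3P) => -[BA B0 nadj]; split=> //.
  by move=> x y xB yAB; move/forall_inP/(_ x xB)/forall_inP/(_ y yAB): nadj.
by apply/forall_inP=> x xB; apply/forall_inP=> y yAB; apply: nadj.
Qed.

Lemma splits_setD A B : splits A B -> splits A (A :\: B).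
Proof.
case/splitsP=> /properP[BA [z zA zB]] /set0Pn[x xB] nadj; apply/splitsP; split.
- by apply/properP; split; [exact: subsetDl|exists x; rewrite ?(subsetP BA) // inE xB].
- by apply/set0Pn; exists z; rewrite inE zB.
- by move=> y w yAB; rewrite setDDr setDv set0U => /setIP[_ wB]; rewrite adj_sym nadj.
Qed.

Lemma unsplittable_crossing_edge A B x y : ~~ splittable A -> B \subset A ->
  x \in B -> y \in A -> y \notin B ->
  exists a b, [/\ a \in B, b \in A, b \notin B & adj a b].
Proof.
rewrite negb_exists => /forallP/(_ B) + BA xB yA yB.
rewrite /splits properE BA (_ : ~~ (A \subset B)) /=; last by apply/subsetPn; exists y.
rewrite (_ : B != set0) /=; last by apply/set0Pn; exists x.
case/forall_inPn=> a aB /forall_inPn[b /setDP[bA bB]]; rewrite negbK => ab.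
by exists a, b.
Qed.

Lemma splits_connected B : splits [set: H] B -> ~ connected H.
Proof.
case/splitsP=> /properP[_ [y _ yB]] /set0Pn[x xB] nadj coH.
have B_closed : closed (@adj H) (mem B).
  apply: (intro_closed (@adj_connect_sym H)) => a b ab aB.
  by apply: contraTT ab => bB; apply: nadj; rewrite // !inE andbT.
by move: yB; rewrite -(closed_connect B_closed (coH x y)) xB.
Qed.

(* If y in B is not adjacent to v, an edge leaving the set of nonneighbours of v
   in B and an edge from A :\: B to v form an induced path on four vertices. *)
Lemma splits_adj A B v : cograph H -> v \notin A -> ~~ splittable (v |: A) ->
  splits A B -> {in B, forall y, adj v y}.
Proof.
move=> cH vA nsplit /splitsP[/properP[BA [z0 z0A z0B]] _ nadj] y yB.
have BvA : B \subset v |: A := subset_trans BA (subsetUr _ _).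
have [z [b [/setDP[zA zB] bvA + zb]]] :
    exists z b, [/\ z \in A :\: B, b \in v |: A, b \notin A :\: B & adj z b].
  apply: (unsplittable_crossing_edge (x := z0) (y := v)) => //;
    rewrite ?inE ?eqxx ?z0B ?(negbTE vA) ?andbF //.
  exact: subset_trans (subsetDl _ _) (subsetUr _ _).
have [bv _ | nbv] := eqVneq b v; last first.
  move: bvA; rewrite !inE (negbTE nbv) /= => bA; rewrite bA andbT negbK => bB.
  by rewrite adj_sym (negbTE (nadj b z bB _)) // inE zB in zb.
rewrite {}bv in zb {bvA}; apply: contraT => nvy.
have [y' [x [/setIdP[y'B nvy'] xvA + y'x]]] :
    exists y x, [/\ y \in [set y in B | ~~ adj v y], x \in v |: A,
                    x \notin [set y in B | ~~ adj v y] & adj y x].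
  apply: (unsplittable_crossing_edge (x := y) (y := v)); rewrite ?inE ?eqxx ?yB //.
  - by apply/subsetP=> x /setIdP[/(subsetP BvA)].
  - by rewrite (contraNF (subsetP BA v)).
have nxv : x != v by apply: contraNneq nvy' => <-; rewrite adj_sym.
have xB : x \in B.
  move: xvA; rewrite !inE (negbTE nxv) /= => xA; apply: contraTT y'x => xB.
  by apply: nadj; rewrite // inE xB.
rewrite inE xB negbK => vx.
have nz u : u \in B -> ~~ adj z u by move=> uB; rewrite adj_sym nadj // inE zB.
have xy' : adj x y' by rewrite adj_sym.
by have := cograph_P4_free cH zb vx xy' (nz x xB) nvy'; rewrite (negbTE (nz y' y'B)).
Qed.

Lemma splits_set2 x y : x != y -> ~~ adj x y -> splits [set x; y] [set x].
Proof.
move=> nxy nadj; apply/splitsP; split.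
- apply/properP; split; first by rewrite sub1set set21.
  by exists y; rewrite ?set22 // inE eq_sym.
- by apply/set0Pn; exists x; rewrite inE.
- by move=> a b /set1P-> /setDP[/set2P[]->]; rewrite ?inE ?eqxx.
Qed.

End Splitting.

Lemma splittable_setU1 (H : sgraph) (A B : {set H}) (v : H) :
  cograph H -> v \notin A -> splits A B ->
  splittable (v |: A) || @splittable (compl H) (v |: A).
Proof.
move=> cH vA sAB; apply: contraT; rewrite negb_or => /andP[nsplit /existsP[]].
exists [set v]; apply/splitsP; split.
- apply/properP; split; first by rewrite sub1set setU11.
  have /splitsP[/properP[_ [y yA _]] _ _] := sAB.
  by exists y; rewrite !inE ?yA ?orbT //; apply: contraNneq vA => <-.
- by apply/set0Pn; exists v; rewrite inE.
- move=> x y /set1P-> /setDP[/setU1P[->|yA]]; first by rewrite inE eqxx.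
  move=> _; rewrite /= /compl_adj negb_and negbK.
  have vAB := splits_adj cH vA nsplit; case: (boolP (y \in B)) => yB.
    by rewrite (vAB _ sAB) ?orbT.
  by rewrite (vAB _ (splits_setD sAB)) ?orbT // inE yB.
Qed.

Lemma splittable_complK (H : sgraph) (A : {set H}) :
  @splittable (compl (compl H)) A = splittable A.
Proof.
apply: eq_existsb => B; congr [&& _, _ & _].
by apply: eq_forallb_in => x _; apply: eq_forallb_in => y _; rewrite compl_adjK.
Qed.

Lemma cograph_splittable (H : sgraph) (A : {set H}) : cograph H -> 1 < #|A| ->
  splittable A || @splittable (compl H) A.
Proof.
move=> cH; have [n] := ubnP #|A|; elim: n A => // n IHn A leAn A_gt1.
have [v vA] : exists v, v \in A by apply/set0Pn; rewrite -card_gt0 ltnW.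
rewrite -(setD1K vA); have vA' : v \notin A :\ v by rewrite !inE eqxx.
move: A_gt1 leAn; rewrite (cardsD1 v A) vA ltnS => A'_gt0 leA'n.
have [A'_gt1 | A'_le1] := ltnP 1 #|A :\ v|.
  have /orP[/existsP[B sAB] | /existsP[B sAB]] := IHn _ leA'n A'_gt1.
    exact: splittable_setU1 sAB.
  rewrite orbC -[X in _ || X]splittable_complK.
  exact: (splittable_setU1 (cograph_compl cH) vA' sAB).
have /cards1P[w A'w] : #|A :\ v| == 1 by rewrite eqn_leq A'_le1.
have nvw : v != w by rewrite A'w inE in vA'.
rewrite A'w; apply/orP.
have [vw | nvw_adj] := boolP (adj v w); [right | left]; apply/existsP; exists [set v].
  by apply: (@splits_set2 (compl H)); rewrite //= /compl_adj vw andbF.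
exact: splits_set2.
Qed.

Lemma cograph_compl_disconnected (H : sgraph) :
  cograph H -> connected H -> 1 < #|H| -> ~ connected (compl H).
Proof.
move=> cH coH; rewrite -cardsT => /(cograph_splittable cH).
by case/orP=> /existsP[B sB]; [case: (splits_connected sB) | apply: splits_connected sB].
Qed.

Section Geodesics.
Variable H : sgraph.
Implicit Types (x y z : H) (p q : seq H).

Lemma shortest_gpathP x y p : reflect
  (gpath x y p /\ forall q, gpath x y q -> size p <= size q) (shortest_gpath x y p).
Proof.
apply: (iffP andP) => -[gp minp]; split=> //.
  move=> q gq; rewrite leqNgt; apply/negP=> ltqp.
  by have /forallP/(_ (in_tuple q)) := forallP minp (Ordinal ltqp); rewrite gq.
apply/forallP=> n; apply/forallP=> q; apply: contraTN (ltn_ord n) => /minp.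
by rewrite size_tuple leqNgt.
Qed.

Lemma intervalP x y z : reflect
  [\/ z = x, z = y | exists2 p, shortest_gpath x y p & z \in x :: p] (z \in interval x y).
Proof.
rewrite !inE -orbA; apply: (iffP or3P) => -[/eqP zx | /eqP zy | ].
- by constructor 1.
- by constructor 2.
- by case/existsP=> n /existsP[p /andP[sp zp]]; constructor 3; exists p.
- by constructor 1.
- by constructor 2.
case=> p sp zp; constructor 3; have : size p < #|H|.
  case/shortest_gpathP: sp => /and3P[_ _ /card_uniqP up] _.
  by rewrite -[_ < _]/(size (x :: p) <= _) -up max_card.
move=> ltp; apply/existsP; exists (Ordinal ltp); apply/existsP; exists (in_tuple p).
by rewrite sp.
Qed.

Lemma interval_endpoints x y : (x \in interval x y) * (y \in interval x y).
Proof. by split; apply/intervalP; [constructor 1 | constructor 2]. Qed.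

Definition midpoint x y z : bool := [&& x != y, ~~ adj x y, adj x z & adj z y].

Definition within2 x y : bool := [|| x == y, adj x y | [exists z, adj x z && adj z y]].

Lemma midpoint_sym x y z : midpoint x y z = midpoint y x z.
Proof.
by rewrite /midpoint eq_sym ![adj y _]adj_sym [adj x z]adj_sym [adj z x && _]andbC.
Qed.

Lemma within2_sym x y : within2 x y = within2 y x.
Proof.
rewrite /within2 eq_sym [adj x y]adj_sym; congr [|| _, _ | _].
by apply: eq_existsb => z; rewrite [adj x z]adj_sym [adj z y]adj_sym andbC.
Qed.

Lemma midpoint_interval x y z : midpoint x y z -> z \in interval x y.
Proof.
case/and4P=> nxy nadj xz zy; apply/intervalP; constructor 3.
exists [:: z; y]; last by rewrite !inE eqxx orbT.
apply/shortest_gpathP; split.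
  by rewrite /gpath /= xz zy eqxx !inE negb_or nxy !adj_neq.
case=> [|a [|b q]] //; rewrite /gpath /=; first by rewrite (negbTE nxy).
by rewrite !andbT; case/and3P=> xa /eqP ay _; rewrite -ay xa in nadj.
Qed.

Lemma within2_gpath x y : within2 x y -> exists2 p, gpath x y p & size p <= 2.
Proof.
rewrite /within2; have [-> _ | nxy /= /orP[xy | /existsP[z /andP[xz zy]]]] := eqVneq x y.
- by exists [::]; rewrite // /gpath /= eqxx.
- by exists [:: y]; rewrite // /gpath /= xy eqxx inE nxy.
- by exists [:: z; y]; rewrite // /gpath /= xz zy eqxx !inE negb_or nxy !adj_neq.
Qed.

Lemma interval_within2 x y z : within2 x y ->
  (z \in interval x y) = [|| z == x, z == y | midpoint x y z].
Proof.
move=> /within2_gpath[q gq q_le2]; apply/idP/or3P => [|[/eqP->|/eqP->|]];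
  rewrite ?interval_endpoints //; last exact: midpoint_interval.
case/intervalP=> [->|->|[p /shortest_gpathP[/and3P[] + + + minp]]].
- by constructor 1.
- by constructor 2.
have := leq_trans (minp q gq) q_le2; case: p minp => [|a [|b []]] minp //= _.
- by move=> _ _ _; rewrite inE => ->; constructor 1.
- by move=> _ /eqP-> _; rewrite !inE => /orP[]->; [constructor 1 | constructor 2].
case/and3P=> xa ab _ /eqP bE; move: ab minp; rewrite {b}bE => ay minp.
rewrite !inE !negb_or => /andP[/andP[_ nxy] _].
case/or3P=> [->|/eqP->|->]; [by constructor 1| |by constructor 2].
constructor 3; rewrite /midpoint nxy xa ay !andbT; apply/negP=> xy.
have : gpath x y [:: y] by rewrite /gpath /= xy eqxx inE nxy.
by move/minp.
Qed.

(* A vertex at distance 3 from x would end an induced path on four vertices. *)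
Lemma cograph_within2 x y : cograph H -> connect (@adj H) x y -> within2 x y.
Proof.
move=> cH xy; have within2_closed : closed (@adj H) (within2 x).
  apply: (intro_closed (@adj_connect_sym H)) => a b ab; rewrite !unfold_in /within2.
  have [//|nxb] := eqVneq x b; have [//|nadj] := boolP (adj x b).
  case/or3P=> [/eqP xa | xa | /existsP[z /andP[xz za]]]; first by rewrite xa ab in nadj.
    by apply/existsP; exists a; rewrite xa.
  apply/existsP; have [zb | nzb] := boolP (adj z b); first by exists z; rewrite xz.
  exists a; rewrite ab andbT; apply: contraR nadj => nxa.
  exact: cograph_P4_free cH xz za ab nxa nzb.
suff: y \in within2 x by [].
by rewrite -(closed_connect within2_closed xy) unfold_in /within2 eqxx.
Qed.

Lemma midpoint_connect x y z : midpoint x y z ->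
  connect (@adj H) x z && connect (@adj H) x y.
Proof.
case/and4P=> _ _ xz zy; rewrite (connect1 xz).
exact: connect_trans (connect1 xz) (connect1 zy).
Qed.

Lemma cograph_interval x y z : cograph H ->
  (z \in interval x y) = [|| z == x, z == y | midpoint x y z].
Proof.
move=> cH; apply/idP/idP => [zi|]; last first.
  by case/or3P=> [/eqP->|/eqP->|/midpoint_interval //]; rewrite interval_endpoints.
case/intervalP: (zi) => [->|->|[p /shortest_gpathP[/and3P[xp /eqP yE _] _] _]];
  rewrite ?eqxx ?orbT // -interval_within2 //.
by apply: cograph_within2 => //; apply/connectP; exists p.
Qed.

End Geodesics.

Section Hulls.
Variable H : sgraph.
Implicit Types S T : {set H}.

Lemma convexP S : reflect
  (forall x y z, x \in S -> y \in S -> z \in interval x y -> z \in S) (convex S).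
Proof.
apply: (iffP eqP) => [eS x y z xS yS zi | convS].
  by rewrite -eS; apply/bigcupP; exists x => //; apply/bigcupP; exists y.
apply/eqP; rewrite eqEsubset; apply/andP; split; apply/subsetP=> z.
  by case/bigcupP=> x xS /bigcupP[y yS]; apply: convS.
move=> zS; apply/bigcupP; exists z => //; apply/bigcupP; exists z => //.
by rewrite interval_endpoints.
Qed.

Lemma convex0 : convex (set0 : {set H}).
Proof. by apply/convexP=> x y z; rewrite inE. Qed.

Lemma cograph_convexP S : cograph H -> reflect
  (forall x y z, x \in S -> y \in S -> midpoint x y z -> z \in S) (convex S).
Proof.
move=> cH; apply: (iffP (convexP S)) => convS x y z xS yS => [/midpoint_interval|].
  exact: convS.
by rewrite (cograph_interval _ _ _ cH) => /or3P[/eqP->|/eqP->|] //; apply: convS.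
Qed.

Lemma hull_setP S : reflect
  (forall T, convex T -> S \subset T -> forall x, x \in T) (hull_set S).
Proof.
apply: (iffP eqP) => [hS T convT ST x | hS].
  have: x \in hull S by rewrite hS.
  by move/bigcapP; apply; rewrite convT.
apply/setP=> x; rewrite [RHS]inE; apply/bigcapP=> T /andP[convT ST]; exact: hS.
Qed.

Lemma hull_setT : hull_set [set: H].
Proof. by apply/hull_setP=> T _ /subsetP sT x; apply: sT. Qed.

Lemma hull_set_neq0 S (x : H) : hull_set S -> S != set0.
Proof.
apply: contraTneq => ->; apply/hull_setP=> /(_ set0 convex0 (subxx _) x).
by rewrite inE.
Qed.

Lemma hull_number_le S : hull_set S -> hull_number H <= #|S|.
Proof.
by move=> hS; rewrite /hull_number; case: arg_minnP => [|T _]; [apply: hull_setT | apply].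
Qed.

Lemma hull_number_attained : exists2 S : {set H}, hull_set S & #|S| = hull_number H.
Proof.
by rewrite /hull_number; case: arg_minnP => [|S hS _]; [apply: hull_setT | exists S].
Qed.

End Hulls.

Section EmbeddedConvexity.
Variables (H K : sgraph) (f : H -> K).
Hypothesis emb : embedding f.

Lemma midpoint_embedding x y z : midpoint (f x) (f y) (f z) = midpoint x y z.
Proof. by case: emb => injf monof; rewrite /midpoint !monof (inj_eq injf). Qed.

Lemma within2_embedding x y : within2 x y -> within2 (f x) (f y).
Proof.
case: emb => injf monof; rewrite /within2 (inj_eq injf) monof.
case/or3P=> [->|->|/existsP[z xzy]]; rewrite ?orbT //.
by apply/or3P; constructor 3; apply/existsP; exists (f z); rewrite !monof.
Qed.

Lemma convex_preimset (T : {set K}) : cograph H -> convex T -> convex (f @^-1: T).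
Proof.
move=> cH /convexP convT; apply/(cograph_convexP _ cH) => x y z; rewrite !inE => xT yT.
by rewrite -midpoint_embedding => /midpoint_interval; apply: convT.
Qed.

Lemma mem_interval_embedding (T : {set K}) x y w : cograph H ->
  connect (@adj H) x y -> (forall v, midpoint (f x) (f y) v -> v \in codom f) ->
  convex (f @^-1: T) -> f x \in T -> f y \in T -> w \in interval (f x) (f y) -> w \in T.
Proof.
move=> cH coxy im_f /(cograph_convexP _ cH) convT xT yT.
rewrite interval_within2 ?within2_embedding ?cograph_within2 //.
case/or3P=> [/eqP->|/eqP->|mid_w] //; case/codomP: (im_f w mid_w) => z wz.
by move: mid_w; rewrite wz midpoint_embedding => /convT; rewrite !inE; apply.
Qed.

End EmbeddedConvexity.

Lemma hull_set_induced (H : sgraph) (C T : {set H}) (S : {set induced H C}) :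
  cograph H -> hull_set S -> convex T -> val @: S \subset T -> C \subset T.
Proof.
move=> cH /hull_setP hS convT ST; apply/subsetP=> x xC.
have emb := embedding_val C; have cC := cograph_embedding emb cH.
have := hS _ (convex_preimset emb cC convT) _ (exist _ x xC); rewrite inE; apply.
by rewrite -sub_imset_pre.
Qed.

Section ComplementaryPrism.
Variable G : sgraph.
Implicit Types (x y z : G) (X Y C : {set G}) (S T : {set cprism G}).

Definition prism_set X Y : {set cprism G} :=
  [set u : cprism G | match u with inl x => x \in X | inr x => x \in Y end].

Lemma preimset_inl_prism_set X Y : inl @^-1: prism_set X Y = X.
Proof. by apply/setP=> x; rewrite !inE. Qed.

Lemma preimset_inr_prism_set X Y : inr @^-1: prism_set X Y = Y.
Proof. by apply/setP=> x; rewrite !inE. Qed.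

Lemma prism_set_subset X Y T :
  (prism_set X Y \subset T) = (X \subset inl @^-1: T) && (Y \subset inr @^-1: T).
Proof.
apply/subsetP/andP=> [XYT | [/subsetP XT /subsetP YT] [] x].
- by split; apply/subsetP=> x xXY; rewrite inE; apply: XYT; rewrite inE.
- by rewrite inE => /XT; rewrite inE.
- by rewrite inE => /YT; rewrite inE.
Qed.

Lemma card_cprism S : #|S| = #|inl @^-1: S| + #|inr @^-1: S|.
Proof.
by rewrite -!sum1_card big_sumType; congr (_ + _); apply: eq_bigl => x; rewrite inE.
Qed.

Lemma card_prism_set X Y : #|prism_set X Y| = #|X| + #|Y|.
Proof. by rewrite card_cprism preimset_inl_prism_set preimset_inr_prism_set. Qed.

Hypotheses (coG : connected G) (cG : cograph G).

Local Notation coconnect := (connect (@adj (compl G))).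
Local Notation cocomponent := (@component (compl G)).

Lemma apart_adj x y : ~~ coconnect x y -> adj x y.
Proof.
apply: contraR => nadj; have [->|nxy] := eqVneq x y; first exact: connect0.
by apply: connect1; rewrite /= /compl_adj nxy.
Qed.

Lemma coconnect1 x y : compl_adj x y -> coconnect x y.
Proof. exact: connect1. Qed.

Lemma within2_inl_inr x y : @within2 (cprism G) (inl x) (inr y).
Proof.
have [<-|nxy] := eqVneq x y; first by rewrite /within2 /= eqxx.
apply/or3P; constructor 3; apply/existsP; case: (boolP (adj x y)) => xy.
  by exists (inl y); rewrite /= xy eqxx.
by exists (inr x); rewrite /= eqxx /compl_adj nxy xy.
Qed.

Lemma gpath_inr_apart x y (p : seq (cprism G)) : ~~ coconnect x y ->
  @gpath (cprism G) (inr x) (inr y) p -> size p <= 3 -> p = [:: inl x; inl y; inr y].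
Proof.
move=> nco /and3P[].
case: p => [|a [|b [|c [|]]]] //= p_path /eqP yE _ _.
- by case: yE nco => ->; rewrite connect0.
- by rewrite yE andbT in p_path; rewrite (coconnect1 p_path) in nco.
- rewrite {}yE in p_path; case: a p_path => a /and3P[xa ay _].
    by rewrite (eqP xa) (eqP ay) connect0 in nco.
  by case/negP: nco; apply: connect_trans (coconnect1 xa) (coconnect1 ay).
rewrite {}yE in p_path *; case: a p_path => a; case: b => b /and4P[xa ab bY _].
- by rewrite (eqP xa) (eqP bY).
- by rewrite (eqP xa) (eqP ab) coconnect1 in nco.
- by rewrite coconnect1 // -(eqP bY) -(eqP ab) in nco.
case/negP: nco; apply: connect_trans (coconnect1 bY).
exact: connect_trans (coconnect1 xa) (coconnect1 ab).
Qed.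

Lemma interval_inr_apart x y (z : cprism G) : ~~ coconnect x y ->
  (z \in @interval (cprism G) (inr x) (inr y)) = (z \in [:: inr x; inl x; inl y; inr y]).
Proof.
move=> nco; set q := [:: inl x; inl y; inr y].
have gq : @gpath (cprism G) (inr x) (inr y) q.
  have nxy : x != y := adj_neq (apart_adj nco).
  by rewrite /gpath /= !eqxx apart_adj //= !inE !negb_or !andbT; do !(apply/andP; split).
apply/intervalP/idP => [[->|->|[p /shortest_gpathP[gp minp]]]|].
- by rewrite mem_head.
- by rewrite !inE eqxx !orbT.
- by rewrite (gpath_inr_apart nco gp (minp q gq)).
move=> zq; constructor 3; exists q => //; apply/shortest_gpathP; split=> // p gp.
rewrite leqNgt; apply/negP=> ltp; have pE := gpath_inr_apart nco gp (ltnW ltp).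
by rewrite pE ltnn in ltp.
Qed.

Lemma cprism_convexP T : reflect
  [/\ convex (inl @^-1: T), @convex (compl G) (inr @^-1: T),
      forall x y, inl x \in T -> inr y \in T -> adj x y -> inl y \in T,
      forall x y, inl x \in T -> inr y \in T -> compl_adj x y -> inr x \in T
    & forall x y, inr x \in T -> inr y \in T -> ~~ coconnect x y -> inl x \in T]
  (convex T).
Proof.
apply: (iffP idP) => [convT | [convl convr mixl mixr apart]].
  have midT u v w : u \in T -> v \in T -> midpoint u v w -> w \in T.
    by move=> uT vT /midpoint_interval; apply: (convexP T convT).
  split=> [||x y xT yT xy|x y xT yT xy|x y xT yT nco].
  - exact: (convex_preimset (embedding_inl G) cG convT).
  - exact: (convex_preimset (embedding_inr G) (cograph_compl cG) convT).
  - by apply: midT xT yT _; rewrite /midpoint /= xy eqxx adj_neq.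
  - by apply: midT xT yT _; case/andP: (xy) => nxy _; rewrite /midpoint /= xy eqxx nxy.
  - by apply: (convexP T convT) xT yT _; rewrite interval_inr_apart // !inE eqxx orbT.
have mid_mixed x y w : inl x \in T -> inr y \in T -> x != y ->
    @adj (cprism G) (inl x) w -> @adj (cprism G) w (inr y) -> w \in T.
  case: w => w xT yT nxy /= => [+ /eqP wy | /eqP<-]; last exact: mixr xT yT.
  by rewrite wy; apply: mixl xT yT.
apply/convexP=> -[] x [] y w xT yT.
- apply: (mem_interval_embedding (embedding_inl G) cG (coG x y) _ convl xT yT).
  case=> v; first by rewrite codom_f.
  by case/and4P=> nxy _ /eqP xv /eqP vy; rewrite xv vy eqxx in nxy.
- rewrite interval_within2 ?within2_inl_inr // => /or3P[/eqP->|/eqP->|] //.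
  by case/and4P=> _ nadj xw wy; apply: mid_mixed xw wy.
- rewrite interval_within2 1?within2_sym ?within2_inl_inr // midpoint_sym.
  case/or3P=> [/eqP->|/eqP->|] //.
  by case/and4P=> _ nadj xw wy; apply: mid_mixed xw wy.
have [coxy | nco] := boolP (coconnect x y); last first.
  rewrite interval_inr_apart // !inE => /or4P[] /eqP-> //; first exact: apart yT nco.
  by apply: apart yT xT _; rewrite (@adj_connect_sym (compl G)).
apply: (mem_interval_embedding (embedding_inr G) (cograph_compl cG) coxy _ convr xT yT).
case=> v; last by rewrite codom_f.
by case/and4P=> nxy _ /eqP xv /eqP vy; rewrite xv vy eqxx in nxy.
Qed.

Lemma convex_setC_cocomponent x : convex (prism_set setT (~: cocomponent x)).
Proof.
apply/cprism_convexP; rewrite preimset_inl_prism_set preimset_inr_prism_set.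
split=> [||y z|y z|y z]; rewrite ?[_ \in prism_set _ _]inE //.
- by apply/(cograph_convexP _ cG) => a b c; rewrite !inE.
- apply/(cograph_convexP _ (cograph_compl cG)) => a b c; rewrite !inE => xa _.
  case/midpoint_connect/andP=> ac _; apply: contra xa => xc.
  by apply: connect_trans xc _; rewrite adj_connect_sym.
rewrite !inE => _ xz yz; apply: contra xz => xy.
exact: connect_trans xy (coconnect1 yz).
Qed.

Lemma convex_cotransversal X :
  {in X &, injective cocomponent} -> convex (prism_set X X).
Proof.
move=> injX; have co_eq x y : x \in X -> y \in X -> coconnect x y -> x = y.
  by move=> xX yX coxy; apply: injX => //; apply/eqP; rewrite eq_component.
apply/cprism_convexP; rewrite preimset_inl_prism_set preimset_inr_prism_set.
split=> [||x y|x y|x y]; rewrite ?[_ \in prism_set _ _]inE //.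
  apply/(cograph_convexP _ cG) => x y z xX yX /and4P[nxy nadj _ _].
  case/eqP: (nxy); apply: co_eq xX yX (coconnect1 _).
  by rewrite /compl_adj nxy.
apply/(cograph_convexP _ (cograph_compl cG)) => x y z xX yX mid.
have /andP[_ coxy] := midpoint_connect mid; case/and4P: mid => /eqP[].
exact: co_eq xX yX coxy.
Qed.

Lemma hull_set_cocomponents S : hull_set S ->
  cocomponent @: (inr @^-1: S) = components (compl G).
Proof.
move=> /hull_setP hS; apply/setP=> C.
apply/imsetP/idP => [[x _ ->] | /imsetP[x _ ->]]; first exact: component_in_components.
have /subsetPn[[y|y] yS] : ~~ (S \subset prism_set setT (~: cocomponent x)).
  apply/negP=> /(hS _ (convex_setC_cocomponent x))/(_ (inr x)).
  by rewrite !inE connect0.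
- by rewrite !inE.
rewrite !inE negbK => coxy; exists y; first by rewrite inE.
by apply/eqP; rewrite -/(component x) eq_component.
Qed.

Lemma leq_components_hull_set S : hull_set S ->
  #|components (compl G)| <= #|inr @^-1: S|.
Proof. by move=> hS; rewrite -(hull_set_cocomponents hS) leq_imset_card. Qed.

Lemma leq_components_hull_number : #|components (compl G)| <= hull_number (cprism G).
Proof.
have [S hS <-] := hull_number_attained (cprism G); rewrite card_cprism.
exact: leq_trans (leq_components_hull_set hS) (leq_addl _ _).
Qed.

(* A hull set with at most one vertex per co-component would consist of the copies
   in the complement of a transversal of the co-components, and the pairs of
   corresponding vertices over that transversal form a convex set. *)
Lemma ltn_components_hull_number : 0 < #|nontrivial_components (compl G)| ->
  #|components (compl G)| < hull_number (cprism G).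
Proof.
case/nontrivial_components_gt0P=> x [y xy].
have [S hS <-] := hull_number_attained (cprism G).
have leX := leq_components_hull_set hS; set X := inr @^-1: S in leX.
rewrite ltnNge card_cprism -/X; apply/negP=> leS.
have inlS0 : inl @^-1: S = set0.
  by apply/eqP; rewrite -cards_eq0 -leqn0 -(leq_add2r #|X|) (leq_trans leS).
have injX : {in X &, injective cocomponent}.
  apply/imset_injP; rewrite eqn_leq leq_imset_card hull_set_cocomponents //.
  exact: leq_trans (leq_addl _ _) leS.
have SX : S \subset prism_set X X.
  apply/subsetP=> -[] z zS; rewrite !inE //.
  by have := in_set0 z; rewrite -inlS0 inE zS.
have XT z : z \in X.
  have := hull_setP _ hS _ (convex_cotransversal injX) SX (inr z).
  by rewrite inE.
have := adj_neq (H := compl G) xy; rewrite (injX x y) ?eqxx //.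
by apply/eqP; rewrite eq_component coconnect1.
Qed.

Lemma convex_inl_full T : convex T -> (forall x, inl x \in T) ->
  (forall x, exists2 r, inr r \in T & coconnect r x) -> forall u, u \in T.
Proof.
case/cprism_convexP=> _ _ _ mixr _ inlT inrT [] x //.
have [r rT co_rx] := inrT x; suff: x \in inr @^-1: T by rewrite inE.
have inrT_closed : closed (@adj (compl G)) (inr @^-1: T).
  apply: (intro_closed (@adj_connect_sym (compl G))) => a b ab; rewrite !inE => aT.
  by apply: mixr (inlT b) aT _; rewrite compl_adj_sym.
by rewrite -(closed_connect inrT_closed co_rx) inE.
Qed.

Lemma inl_apart_edge T x y z : convex T -> compl_adj x y ->
  inl x \in T -> inl y \in T -> ~~ coconnect x z -> inl z \in T.
Proof.
case/cprism_convexP=> /(cograph_convexP _ cG) convl _ _ _ _ xy xT yT nco.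
suff: z \in inl @^-1: T by rewrite inE.
apply: (convl x y); rewrite ?inE //; case/andP: (xy) => nxy nadj.
rewrite /midpoint nxy nadj apart_adj // adj_sym apart_adj //.
by apply: contra nco => /(connect_trans (coconnect1 xy)).
Qed.

(* The edge x1 y1 yields all of G outside its co-component, hence the edge x2 y2 there,
   which in turn yields the co-component of x1. *)
Lemma inl_full_apart_edges T x1 y1 x2 y2 : convex T ->
  compl_adj x1 y1 -> compl_adj x2 y2 -> ~~ coconnect x1 x2 ->
  inl x1 \in T -> inl y1 \in T -> forall z, inl z \in T.
Proof.
move=> convT xy1 xy2 nco x1T y1T z.
have outside u : ~~ coconnect x1 u -> inl u \in T := inl_apart_edge convT xy1 x1T y1T.
have [co_x1z | /outside //] := boolP (coconnect x1 z).
apply: (inl_apart_edge convT xy2); try apply: outside => //.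
  apply: contra nco => co_x1y2; apply: connect_trans co_x1y2 _.
  by rewrite adj_connect_sym coconnect1.
apply: contra nco => co_x2z; apply: connect_trans co_x1z _.
by rewrite adj_connect_sym.
Qed.

Lemma hull_number_cprism_le_componentsS : 1 < #|nontrivial_components (compl G)| ->
  hull_number (cprism G) <= #|components (compl G)|.+1.
Proof.
have sym := @adj_connect_sym (compl G); pose r := root (@adj (compl G)).
rewrite nontrivial_componentsE => /card_gt1P[C1 [C2 [/imsetP[x1 + ->] /imsetP[x2 + ->]]]].
rewrite !in_setC eq_component => x1N x2N nco12.
have rN x : x \notin isolated (compl G) -> r x \notin isolated (compl G).
  by rewrite -(@connect_isolated (compl G) _ _ (connect_root _ x)).
have [/isolatedPn[y1 r1y1] /isolatedPn[y2 r2y2]] := (rN _ x1N, rN _ x2N).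
have nco : ~~ coconnect (r x1) (r x2).
  by rewrite -root_connect // !root_root // root_connect.
have nco_y1 : ~~ coconnect y1 (r x2).
  by apply: contra nco => /(connect_trans (coconnect1 r1y1)).
pose X := y1 |: [set x in roots (@adj (compl G))].
apply: (@leq_trans #|prism_set set0 X|); last first.
  by rewrite card_prism_set cards0 cardsU1 -card_roots add0n -add1n leq_add ?leq_b1 ?cardsE.
apply/hull_number_le/hull_setP=> T convT; rewrite prism_set_subset => /andP[_ /subsetP XT].
have rT x : inr (r x) \in T.
  by have := XT (r x); rewrite !inE; apply; rewrite orbC (roots_root sym).
have y1T : inr y1 \in T by have := XT y1; rewrite !inE eqxx; apply.
have /cprism_convexP[_ _ _ _ apart] := convT.
apply: convex_inl_full => // [|x]; last by exists (r x); rewrite // sym connect_root.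
apply: (inl_full_apart_edges convT r1y1 r2y2 nco).
  exact: apart (rT x1) (rT x2) nco.
exact: apart y1T (rT x2) nco_y1.
Qed.

Section AtLeastTwoVertices.
Hypothesis G_gt1 : 1 < #|G|.

Lemma apart_exists x : exists y, ~~ coconnect x y.
Proof.
apply/existsP; rewrite -negb_forall; apply/negP=> /forallP co_x.
case: (cograph_compl_disconnected cG coG G_gt1) => y z.
by apply: connect_trans (co_x z); rewrite adj_connect_sym; apply: co_x.
Qed.

Lemma convex_inr_full T : convex T -> (forall x, inr x \in T) -> forall u, u \in T.
Proof.
case/cprism_convexP=> _ _ _ _ apart inrT [] x //.
by have [y nco] := apart_exists x; apply: apart nco.
Qed.

Lemma hull_number_cprism_le_card : hull_number (cprism G) <= #|G|.
Proof.
rewrite -cardsT -[X in _ <= X]add0n -(cards0 G) -card_prism_set.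
apply/hull_number_le/hull_setP=> T convT.
rewrite prism_set_subset => /andP[_ /subsetP inrT].
by apply: convex_inr_full => // x; have := inrT x (in_setT x); rewrite inE.
Qed.

Lemma hull_number_cprism_le_compl C :
  hull_number (cprism G) <= hull_number (induced (compl G) C) + #|~: C|.
Proof.
have [S hS <-] := hull_number_attained (induced (compl G) C).
apply: (@leq_trans #|prism_set set0 (val @: S :|: ~: C)|); last first.
  rewrite card_prism_set cards0 (leq_trans (leq_card_setU _ _)) //.
  by rewrite leq_add2r leq_imset_card.
apply/hull_number_le/hull_setP=> T convT; rewrite prism_set_subset subUset.
case/and3P=> _ ST /subsetP outC; apply: (convex_inr_full convT) => x.
have /cprism_convexP[_ convr _ _ _] := convT.
have /subsetP inrC := hull_set_induced (cograph_compl cG) hS convr ST.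
have [xC | xC] := boolP (x \in C); first by have := inrC x xC; rewrite inE.
by have := outC x; rewrite !inE; apply.
Qed.

(* The vertex inl (val x0), traded for inr (val x0), is recovered between inr (val x0)
   and inr u for any u apart from val x0. *)
Lemma hull_number_cprism_le_induced C : C \in components (compl G) ->
  hull_number (cprism G) <= hull_number (induced G C) + #|~: C|.
Proof.
case/imsetP=> c _ CE; have cC : c \in C by rewrite CE mem_component.
have [S hS <-] := hull_number_attained (induced G C).
have /set0Pn[x0 x0S] := hull_set_neq0 (exist _ c cC : induced G C) hS.
have coC x : (x \in C) = coconnect (val x0) x.
  have inC y : (y \in C) = coconnect c y by rewrite CE inE.
  have := valP x0; rewrite !inC => c_x0.
  by rewrite (same_connect (@adj_connect_sym (compl G)) c_x0).
pose Y := val x0 |: ~: C.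
apply: (@leq_trans #|prism_set (val @: (S :\ x0)) Y|); last first.
  rewrite card_prism_set [#|S|](cardsD1 x0) x0S -addnA addnCA leq_add ?leq_imset_card //.
  by rewrite cardsU1 leq_add2r leq_b1.
apply/hull_number_le/hull_setP=> T convT; rewrite prism_set_subset => /andP[ST /subsetP YT].
have /cprism_convexP[convl _ _ _ apart] := convT.
have inrT x : (x \notin C) || (x == val x0) -> inr x \in T.
  by move=> xY; have := YT x; rewrite !inE orbC; apply.
have x0T : inl (val x0) \in T.
  have [u nco] := apart_exists (val x0).
  by apply: (apart _ u); rewrite // inrT ?eqxx ?orbT // coC nco.
have /subsetP CT : C \subset inl @^-1: T.
  apply: hull_set_induced cG hS convl _; rewrite -(setD1K x0S) imsetU1 subUset ST.
  by rewrite sub1set inE x0T.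
apply: convex_inl_full => // x; have [xC | xC] := boolP (x \in C).
- by have := CT x xC; rewrite inE.
- by apply: (apart x (val x0)); rewrite ?inrT ?xC ?eqxx ?orbT // adj_connect_sym -coC.
- by exists (val x0); rewrite ?inrT ?eqxx ?orbT // -coC.
- by exists x; rewrite ?inrT ?xC.
Qed.

End AtLeastTwoVertices.

End ComplementaryPrism.

Theorem theorem7 (G : sgraph) (k t : nat) :
  connected G -> cograph G -> 1 < #|G| ->
  k = #|nontrivial_components (compl G)| ->
  t = #|trivial_components (compl G)| ->
  [/\ k = 0 -> hull_number (cprism G) = t,
      k = 1 -> forall C : {set G}, C \in nontrivial_components (compl G) ->
        t + 2 <= hull_number (cprism G)
        <= minn (hull_number (induced G C))
                (hull_number (induced (compl G) C)) + t
    & 2 <= k -> hull_number (cprism G) = k + t + 1].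
Proof.
move=> coG cG G_gt1 kE tE.
have ktE : #|components (compl G)| = k + t by rewrite card_components kE tE.
have tI : t = #|isolated (compl G)| by rewrite tE card_trivial_components.
split=> [k0 | k1 C CN | k_gt1].
- have lower : t <= hull_number (cprism G).
    by have := leq_components_hull_number coG cG; rewrite ktE k0.
  apply/eqP; rewrite eqn_leq lower andbT tI isolatedT -?kE // cardsT.
  exact: hull_number_cprism_le_card.
- have /setIdP[CC _] := CN.
  have isoC : #|~: C| = t by rewrite tI (isolated_setC _ CN) -?kE.
  have := ltn_components_hull_number coG cG; rewrite ktE -kE k1 => /(_ isT) lower.
  rewrite addn2 -[t.+1]add1n lower /= addn_minl leq_min -isoC.
  apply/andP; split; first exact: hull_number_cprism_le_induced.
  exact: hull_number_cprism_le_compl.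
- apply/eqP; rewrite eqn_leq addn1 -ktE.
  by rewrite hull_number_cprism_le_componentsS ?ltn_components_hull_number -?kE // ltnW.
Qed.
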